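(* Let $G$ be a finite simple graph with $p\ge1$ vertices and $q$ edges, and write $q=tp+t_0$ with $t$ a nonnegative integer and $0\le t_0\le p-1$. Then the double graph $\mathcal{D}[G]$ is max-$\kappa$ if and only if $G$ is max-$\kappa$ and either $0\le t_0<\frac{p}{4}$ or $\frac{p}{2}\le t_0<\frac{3p}{4}$.
   Context: The total graph $T_2$ is $K_2$ with a loop added at each of its two vertices. The double graph is $\mathcal{D}[G]=G\times T_2$ (Kronecker product): it has vertex set $V(G)\times\{0,1\}$ and $(u,i)$ is adjacent to $(v,j)$ iff $uv\in E(G)$. For a graph $H$ with $p(H)\ge1$ vertices and $q(H)$ edges, $H$ is called max-$\kappa$ if $\kappa(H)=\lfloor 2q(H)/p(H)\rfloor$, where $\kappa$ is vertex-connectivity. *)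

(* Defs.v *)
From mathcomp Require Import all_boot.

Set Implicit Arguments.
Unset Strict Implicit.
Unset Printing Implicit Defensive.

(* Loops are allowed, because T_2 has some; a simple graph is a graph that    *)
(* satisfies [simple_graph].                                                  *)
Record graph := Graph {
  vertex :> finType;
  adj : rel vertex;
  adj_sym : symmetric adj
}.

Definition simple_graph (G : graph) : Prop := irreflexive (@adj G).

Definition nvertices (G : graph) : nat := #|G|.

(* An edge is the set of its two ends; a loop at x is the singleton of x.     *)
Definition edges (G : graph) : {set {set G}} :=
  [set [set xy.1; xy.2] | xy : G * G & adj xy.1 xy.2].

Definition nedges (G : graph) : nat := #|edges G|.

Definition kronecker_adj (G H : graph) : rel (G * H) :=
  [rel x y | adj x.1 y.1 && adj x.2 y.2].

Lemma kronecker_sym (G H : graph) : symmetric (@kronecker_adj G H).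
Proof. by move=> x y; rewrite /kronecker_adj /= adj_sym [adj x.2 _]adj_sym. Qed.

Definition kronecker_graph (G H : graph) : graph := Graph (@kronecker_sym G H).

Lemma total2_sym : symmetric [rel i j : 'I_2 | (i != j) || (i == j)].
Proof. by move=> i j /=; rewrite eq_sym. Qed.

(* K_2 (adjacency i != j) with a loop (i == j) added at each vertex.          *)
Definition total2 : graph := Graph total2_sym.

Definition double_graph (G : graph) : graph := kronecker_graph G total2.

Lemma double_graph_adjE (G : graph) (x y : double_graph G) : adj x y = adj x.1 y.1.
Proof. by rewrite /= /kronecker_adj /= orNb andbT. Qed.

Lemma double_graph_simple (G : graph) : simple_graph G -> simple_graph (double_graph G).
Proof. by move=> G_irr x; rewrite double_graph_adjE G_irr. Qed.

(* Connectedness of the subgraph induced by A.                                *)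
Definition connected_on (G : graph) (A : {set G}) : bool :=
  [forall x in A, forall y in A,
     connect [rel u v | [&& u \in A, v \in A & adj u v]] x y].

(* Deleting S leaves a disconnected graph or a single vertex.                 *)
Definition separating (G : graph) (S : {set G}) : bool :=
  ~~ connected_on (~: S) || (#|~: S| == 1).

(* The least size of a separating set. In a graph with a vertex, deleting all *)
(* the other vertices is separating, so the default value nvertices G is      *)
(* never attained; the complete graph on n vertices gets n - 1.               *)
Definition kappa (G : graph) : nat :=
  \big[minn/nvertices G]_(S : {set G} | separating S) #|S|.

Definition max_kappa (H : graph) : Prop :=
  0 < nvertices H /\ kappa H = (2 * nedges H) %/ nvertices H.

(* Main.v *)
Require Import Defs.
From mathcomp Require Import all_boot all_order all_algebra.
From mathcomp Require Import zify.

(** The connectivity doubles, [kappa (D[G]) = 2 * kappa G]: both copies of a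
    separating set of [G] separate [D[G]] (the two copies of a single remaining
    vertex are not adjacent); conversely, if a set separates [D[G]], then the
    vertices both of whose copies it contains separate [G]. The number of edges
    is multiplied by 4, so [D[G]] is max-kappa iff
    [2 * kappa G = floor (4q/p)], i.e. iff [kappa G = floor (2q/p)] and
    [floor (4q/p)] is even; the latter has the parity of [floor (4 t0/p)]. *)

Import Order.TTheory GRing.Theory Num.Theory.

Lemma kappa_le (G : graph) (S : {set G}) : separating S -> kappa G <= #|S|.
Proof.
move=> sepS; rewrite /kappa.
elim: (index_enum _) (mem_index_enum S) => // T s IHs.
rewrite inE big_cons => /orP[/eqP <-|/IHs le_s]; first by rewrite sepS geq_minl.
by case: ifP => // _; rewrite geq_min le_s orbT.
Qed.

Lemma kappa_le_nvertices (G : graph) : kappa G <= nvertices G.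
Proof.
apply: (big_ind (fun m => m <= nvertices G)) => [|a b|S _]; last exact: max_card.
  exact: leqnn.
by rewrite geq_min => ->.
Qed.

(** The first hypothesis handles the default value of the iterated minimum. *)
Lemma leq_kappa (G : graph) (m : nat) : m <= nvertices G ->
  (forall S : {set G}, separating S -> m <= #|S|) -> m <= kappa G.
Proof.
by move=> mG mS; apply: (big_ind (leq m)) => // a b; rewrite leq_min => -> ->.
Qed.

(** Sending an adjacent ordered pair to its set of ends has fibres [{(a, b), (b, a)}], of size two
    since there are no loops. *)
Lemma card_adj (G : graph) : simple_graph G ->
  #|[pred xy : G * G | adj xy.1 xy.2]| = 2 * nedges G.
Proof.
move=> Gs; pose ends (xy : G * G) := [set xy.1; xy.2].
rewrite -sum1_card (partition_big ends (fun e => e \in edges G)) => [|xy xyA]; last first.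
  by apply/imsetP; exists xy; rewrite ?inE.
rewrite mulnC /nedges -sum_nat_const; apply: eq_bigr => _ /imsetP[[a b] /[!inE] /= ab ->].
have neq_ab : a != b by apply: contraTneq ab => ->; rewrite Gs.
rewrite sum1_card (_ : 2 = #|[set (a, b); (b, a)]|); last first.
  by rewrite cards2 xpair_eqE negb_and neq_ab.
apply: eq_card => -[x y]; rewrite !inE /ends !xpair_eqE /=.
apply/andP/idP => [[xy /eqP eq_e]|/orP[] /andP[/eqP-> /eqP->]]; last 2 first.
- by rewrite inE /= ab eqxx.
- by rewrite inE /= adj_sym ab setUC eqxx.
have neq_xy : x != y by apply: contraTneq xy => ->; rewrite inE /= Gs.
have: x \in [set a; b] by rewrite -eq_e !inE eqxx.
have: y \in [set a; b] by rewrite -eq_e !inE eqxx orbT.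
rewrite !inE => /orP[]/eqP yE /orP[]/eqP xE;
  by move: neq_xy; rewrite xE yE ?eqxx ?orbT.
Qed.

Lemma nvertices_double (G : graph) : nvertices (double_graph G) = 2 * nvertices G.
Proof. by rewrite /nvertices card_prod card_ord mulnC. Qed.

(** Counted as ordered pairs, each adjacency of [G] lifts once for every choice of two levels in
    ['I_2 * 'I_2]. *)
Lemma nedges_double (G : graph) : simple_graph G ->
  nedges (double_graph G) = 4 * nedges G.
Proof.
move=> Gs; suff: 2 * nedges (double_graph G) = 4 * (2 * nedges G) by lia.
rewrite -!card_adj //; last exact: double_graph_simple.
pose f (z : (G * G) * ('I_2 * 'I_2)) : double_graph G * double_graph G :=
  ((z.1.1, z.2.1), (z.1.2, z.2.2)).
pose g (w : double_graph G * double_graph G) := ((w.1.1, w.2.1), (w.1.2, w.2.2)).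
have fK : cancel f g by move=> [[? ?] [? ?]].
rewrite -[4]/(2 * 2) -[in RHS](card_ord 2) -card_prod mulnC.
rewrite -[X in _ * X]/#|[pred z : 'I_2 * 'I_2 | true]| -cardX -(card_image (can_inj fK)).
apply: eq_card => -[[x i] [y j]]; rewrite [LHS]inE double_graph_adjE /=.
apply/idP/imageP => [xy|[[[a b] [k l]]]].
  by exists ((x, y), (i, j)) => //; rewrite !inE xy.
by rewrite !inE andbT /= => ab [-> _ -> _].
Qed.

Section DoubleSeparating.
Variable G : graph.
Local Notation D := (double_graph G).
Implicit Types (A S : {set G}) (B T : {set D}).

Lemma connect_lift B (x y : D) : x \in B -> y \in B -> adj x.1 y.1 ->
  connect [rel u v : D | [&& u \in B, v \in B & adj u v]] x y.
Proof.
move=> xB yB xy; have xyD : adj x y by rewrite double_graph_adjE.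
by apply: connect1; apply/and3P.
Qed.

(** Adjacency in [D] ignores levels, so a walk in the projection lifts through arbitrary preimages.
    Two copies of one vertex are joined through a vertex of [B] over another point, which exists
    because the projection is not a singleton. *)
Lemma connected_on_fst B : #|fst @: B| != 1 -> connected_on (fst @: B) ->
  connected_on B.
Proof.
set A := fst @: B => A1 connA.
have lift x y : x \in B -> y \in B -> x.1 != y.1 ->
    connect [rel u v : D | [&& u \in B, v \in B & adj u v]] x y.
  move=> xB yB; have /connectP[s] := forall_inP (forall_inP connA _ (imset_f _ xB))
    _ (imset_f fst yB).
  elim: s x xB => [|c s IHs] x xB /=; first by move=> _ ->; rewrite eqxx.
  case/andP=> /and3P[_ cA xc] path_s last_s neq_xy.
  (* Once the walk reaches [y.1], the lift jumps to [y] itself; before that, any preimage [z] of [c]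
     serves. *)
  have [cE|neq_cy] := eqVneq c y.1.
    by apply: connect_lift; rewrite -?cE.
  have [z zB zE] := imsetP cA.
  apply: (connect_trans (y := z)).
    by apply: connect_lift; rewrite -?zE.
  by apply: IHs; rewrite -?zE.
apply/forall_inP => x xB; apply/forall_inP => y yB.
have [xyE|] := eqVneq x.1 y.1; last exact: lift.
have [w wB neq_w] : exists2 w, w \in B & w.1 != x.1.
  apply/exists_inP; apply: contraR A1 => /exists_inPn noB.
  apply/cards1P; exists x.1; apply/setP => a; rewrite inE.
  apply/imsetP/eqP => [[w /noB/negPn/eqP ? ->] //|->].
  by exists x.
by apply: (connect_trans (y := w)); apply: lift; rewrite // -?xyE // eq_sym.
Qed.

Lemma connected_on_setX A : simple_graph G ->
  connected_on (setX A setT : {set D}) -> connected_on A /\ #|A| != 1.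
Proof.
move=> Gs connB.
have conn x y (i j : 'I_2) : x \in A -> y \in A -> connect
    [rel u v : D | [&& u \in setX A setT, v \in setX A setT & adj u v]] (x, i) (y, j).
  by move=> xA yA; apply: (forall_inP (forall_inP connB _ _)); rewrite !inE ?xA ?yA.
split.
  apply/forall_inP => x xA; apply/forall_inP => y yA.
  have /connectP[s path_s last_s] := conn x y ord0 ord0 xA yA.
  apply/connectP; exists (map fst s); last by rewrite -[x]/(x, @ord0 1).1 last_map -last_s.
  apply: (homo_path (x := (x, ord0)) (f := fst)) path_s => u v /=.
  by rewrite !inE !andbT /kronecker_adj /= orNb andbT.
apply/negP => /cards1P[v AE].
have vA : v \in A by rewrite AE set11.
(* A path between the two copies of [v] has a first step, which would project to a loop at [v]. *)
have /connectP[[|z s] /=] := conn v v ord0 ord_max vA vA; first by [].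
rewrite AE !inE /kronecker_adj /= !andbT orNb andbT => /andP[/and3P[_ /eqP->]].
by rewrite Gs.
Qed.

Lemma separating_setX S : simple_graph G -> separating S ->
  separating (setX S setT : {set D}).
Proof.
move=> Gs; rewrite /separating.
have -> : ~: (setX S setT : {set D}) = setX (~: S) setT.
  by apply/setP => x; rewrite !inE !andbT.
case: (boolP (connected_on (setX _ _ : {set D}))) => // /(connected_on_setX _ Gs)[-> /negPf->].
by [].
Qed.

(** The new set consists of the vertices with both copies in [T]; its complement is the projection
    of what [T] leaves. *)
Lemma separating_fst T : separating T -> separating (~: (fst @: ~: T)).
Proof.
rewrite /separating setCK; case/orP=> [|/cards1P[x ->]]; last first.
  by rewrite imset_set1 cards1 eqxx orbT.
by apply: contraR; rewrite negb_or negbK => /andP[conn A1]; apply: connected_on_fst.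
Qed.

Lemma kappa_double : simple_graph G -> kappa D = 2 * kappa G.
Proof.
move=> Gs; apply/eqP; rewrite eqn_leq; apply/andP; split.
  apply: (big_ind (fun m => kappa D <= 2 * m)) => [|a b|S sepS].
  - rewrite -nvertices_double; exact: kappa_le_nvertices.
  - by rewrite minnMr leq_min => -> ->.
  - by have := kappa_le _ _ (separating_setX _ Gs sepS); rewrite cardsX cardsT card_ord mulnC.
apply: leq_kappa => [|T sepT].
  by rewrite nvertices_double leq_mul2l kappa_le_nvertices.
apply: (@leq_trans (2 * #|~: (fst @: ~: T)|)).
  by rewrite leq_mul2l kappa_le ?separating_fst.
(* Both copies of each vertex of this set lie in [T], whence the factor 2. *)
rewrite mulnC -[X in _ * X](card_ord 2) -cardsT -cardsX; apply: subset_leq_card.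
apply/subsetP => x; rewrite !inE andbT; apply: contraR => xT.
by apply: imset_f; rewrite inE.
Qed.

End DoubleSeparating.

Local Open Scope ring_scope.

Theorem theorem2p3 (G : graph) (G_simple : simple_graph G) (p q t t0 : nat)
    (p_def : p = nvertices G) (q_def : q = nedges G) (p_ge1 : (1 <= p)%N)
    (q_div : q = (t * p + t0)%N) (t0_le : (0 <= t0 <= p - 1)%N) :
  max_kappa (double_graph G) <->
  max_kappa G /\
  (0 <= (t0%:R : rat) < p%:R / 4%:R \/
   p%:R / 2%:R <= (t0%:R : rat) < 3%:R * p%:R / 4%:R).
Proof.
have lt4 : ((t0%:R : rat) < p%:R / 4%:R) = (4 * t0 < p)%N.
  by rewrite ltr_pdivlMr // -natrM ltr_nat mulnC.
have ge2 : (p%:R / 2%:R <= (t0%:R : rat)) = (p <= 2 * t0)%N.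
  by rewrite ler_pdivrMr // -natrM ler_nat mulnC.
have lt34 : ((t0%:R : rat) < 3%:R * p%:R / 4%:R) = (4 * t0 < 3 * p)%N.
  by rewrite ltr_pdivlMr // -!natrM ltr_nat mulnC.
rewrite lt4 ge2 lt34 ler0n /max_kappa nvertices_double kappa_double //.
rewrite nedges_double // -p_def -q_def.
have -> : (2 * (4 * q) %/ (2 * p) = 4 * t + 4 * t0 %/ p)%N.
  by rewrite divnMl // q_div mulnDr mulnA divnMDl.
have -> : (2 * q %/ p = 2 * t + 2 * t0 %/ p)%N.
  by rewrite q_div mulnDr mulnA divnMDl.
have := divn_eq (4 * t0) p; have := ltn_pmod (4 * t0) p_ge1.
have := divn_eq (2 * t0) p; have := ltn_pmod (2 * t0) p_ge1.
move: (kappa G) (4 * t0 %/ p)%N (4 * t0 %% p)%N (2 * t0 %/ p)%N (2 * t0 %% p)%N.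
move=> k a r b s s_lt bE r_lt aE.
(* Here [a] and [b] are the floors of [4 * t0 / p] and [2 * t0 / p], bounded because [t0 < p]. The
   equation [2 * k = 4 * t + a] forces [a] to be 0 or 2, which are the two ranges of [t0], and then
   [b] is half of [a]. *)
have b_lt : (b < 2)%N by nia.
have a_lt : (a < 4)%N by nia.
by case: b bE b_lt => [|[|//]]; case: a aE a_lt => [|[|[|[|//]]]]; lia.
Qed.
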